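(* Let $\alpha,\gamma,\theta,\lambda,\beta$ be real constants and $f_0,f_1$ given functions. The periodic initial-value problem $$u_{tt}-u_{xx}+\gamma u_{tx}-i\alpha u_t-i\theta u_x+\lambda u+\beta|u|^2u=0,\qquad (x,t)\in[x_l,x_r]\times(0,T],$$ $$u(x,t)=u(x+(x_r-x_l),t),\qquad u(x,0)=f_0(x),\quad u_t(x,0)=f_1(x),\quad x\in[x_l,x_r],$$ satisfies the following conservation laws: (Energy invariant) $$\mathcal{E}(t)=\int_{x_l}^{x_r}\Big(|u_t|^2+|u_x|^2+i\theta\,u\,\overline{u_x}+\lambda|u|^2+\frac{\beta}{2}|u|^4\Big)\,dx=\mathcal{E}(0);$$ (Mass invariant) $$\mathcal{Q}(t)=\int_{x_l}^{x_r}\Big[(u_t\overline{u}-\overline{u_t}\,u)-\gamma\,u\,\overline{u_x}-i\alpha|u|^2\Big]\,dx=\mathcal{Q}(0).$$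
   Context: Here $u=u(x,t)$ is complex-valued, $i^2=-1$, the bar denotes complex conjugation, and subscripts $t,x$ denote partial derivatives. The equation is the $(1+1)$-dimensional nonlinear Schrödinger equation with wave operator, with spatially periodic boundary condition of period $x_r-x_l$. *)

(* Defs.v *)
From Stdlib Require Export Reals.
From Coquelicot Require Export Coquelicot.

Local Open Scope R_scope.
Local Open Scope C_scope.

(* Derivative of f : R -> C, as a function of a real variable, along the set D;
   it is one-sided at the end points when D is an interval. *)
Definition is_derive_within (D : R -> Prop) (f : R -> C) (t : R) (l : C) : Prop :=
  filterdiff (K := R_AbsRing) (U := R_NormedModule) (V := C_R_NormedModule)
    f (within D (locally t))
    (fun h : R => scal (V := C_R_NormedModule) h l).

Definition is_partial_x (I : R -> Prop) (v vx : R -> R -> C) : Prop :=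
  forall x t : R, I t ->
    is_derive (K := R_AbsRing) (V := C_R_NormedModule)
      (fun y => v y t) x (vx x t).

Definition is_partial_t (T : R) (I : R -> Prop) (v vt : R -> R -> C) : Prop :=
  forall x t : R, I t ->
    is_derive_within (fun s => 0 <= s <= T)%R (fun s => v x s) t (vt x t).

Definition jointly_continuous (I : R -> Prop) (v : R -> R -> C) : Prop :=
  continuous_on (T := prod_UniformSpace R_UniformSpace R_UniformSpace)
    (U := C_R_NormedModule)
    (fun p => I (snd p)) (fun p => v (fst p) (snd p)).

(* Regularity of a classical solution of a second-order evolution equation
   posed for 0 < t <= T with data at t = 0: u is C^1 on R x [0,T] and C^2 on
   R x (0,T], with the indicated partial derivatives.
   Here utx is (u_t)_x and uxt is (u_x)_t. *)
Record classical_regularity (T : R) (u ut ux utt utx uxt uxx : R -> R -> C)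
  : Prop := {
  reg_ut  : is_partial_t T (fun t => 0 <= t <= T)%R u ut;
  reg_ux  : is_partial_x (fun t => 0 <= t <= T)%R u ux;
  reg_utt : is_partial_t T (fun t => 0 < t <= T)%R ut utt;
  reg_utx : is_partial_x (fun t => 0 < t <= T)%R ut utx;
  reg_uxt : is_partial_t T (fun t => 0 < t <= T)%R ux uxt;
  reg_uxx : is_partial_x (fun t => 0 < t <= T)%R ux uxx;
  cont_u   : jointly_continuous (fun t => 0 <= t <= T)%R u;
  cont_ut  : jointly_continuous (fun t => 0 <= t <= T)%R ut;
  cont_ux  : jointly_continuous (fun t => 0 <= t <= T)%R ux;
  cont_utt : jointly_continuous (fun t => 0 < t <= T)%R utt;
  cont_utx : jointly_continuous (fun t => 0 < t <= T)%R utx;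
  cont_uxt : jointly_continuous (fun t => 0 < t <= T)%R uxt;
  cont_uxx : jointly_continuous (fun t => 0 < t <= T)%R uxx
}.

(* The integrands are complex-valued, so both invariants are complex numbers. *)
Definition energy (xl xr theta lambda beta : R) (u ut ux : R -> R -> C) (t : R)
  : C :=
  RInt (V := C_R_CompleteNormedModule)
    (fun x => RtoC (Cmod (ut x t) ^ 2) + RtoC (Cmod (ux x t) ^ 2)
              + Ci * RtoC theta * u x t * Cconj (ux x t)
              + RtoC lambda * RtoC (Cmod (u x t) ^ 2)
              + RtoC (beta / 2) * RtoC (Cmod (u x t) ^ 4))
    xl xr.

Definition mass (xl xr alpha gamma : R) (u ut ux : R -> R -> C) (t : R) : C :=
  RInt (V := C_R_CompleteNormedModule)
    (fun x => (ut x t * Cconj (u x t) - Cconj (ut x t) * u x t)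
              - RtoC gamma * u x t * Cconj (ux x t)
              - Ci * RtoC alpha * RtoC (Cmod (u x t) ^ 2))
    xl xr.

(* Main.v *)
(* Split u = p + i q. Each invariant then has real and imaginary parts whose
   densities F satisfy, by the equation and u_tx = u_xt, a local law F_t = G_x
   with a flux G polynomial in p, q and their first derivatives; periodicity
   makes G agree at both end points, so the integral of F has zero derivative for
   0 < t < T and is continuous on [0, T]. The multipliers are the conjugate of
   u_t for the energy and the conjugate of u for the mass. *)
Require Import Defs.
From Stdlib Require Import Lra.

Local Open Scope R_scope.

(** * Clamped time and continuity in two variables *)

Definition clamp (T s : R) : R := Rmax 0 (Rmin s T).

Lemma clamp_id (T s : R) : 0 <= s <= T -> clamp T s = s.
Proof.
  intros [H0 HT]; unfold clamp.
  rewrite Rmin_left by exact HT; now apply Rmax_right.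
Qed.

Lemma clamp_range (T s : R) : 0 < T -> 0 <= clamp T s <= T.
Proof.
  intros HT; unfold clamp, Rmax, Rmin.
  destruct (Rle_dec s T); destruct (Rle_dec _ _); lra.
Qed.

Lemma clamp_contracting (T s t : R) :
  0 < T -> Rabs (clamp T s - clamp T t) <= Rabs (s - t).
Proof.
  intros HT; unfold clamp, Rmax, Rmin.
  destruct (Rle_dec s T); destruct (Rle_dec t T);
    repeat destruct (Rle_dec _ _); unfold Rabs;
    repeat destruct (Rcase_abs _); lra.
Qed.

Lemma open_interval_locally (a b t : R) :
  a < t < b -> locally t (fun s => a < s < b).
Proof.
  intros [Ha Hb]; apply (open_and (fun s => a < s) (fun s => s < b)).
  - apply open_gt.
  - apply open_lt.
  - now split.
Qed.

(** The strip is unbounded in the first variable, so a radius that fits the time interval serves for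
    both. *)
Lemma strip_locally_2d (P : R -> R -> Prop) (a b x t : R) :
  a < t < b -> (forall y s, a < s < b -> P y s) -> locally_2d P x t.
Proof.
  intros Ht HP.
  destruct (open_interval_locally a b t Ht) as [d Hd].
  exists d; intros y s _ Hs; apply HP, Hd, Hs.
Qed.

Lemma continuity_2d_pt_flip (f : R -> R -> R) (x y : R) :
  continuity_2d_pt f x y -> continuity_2d_pt (fun v u => f u v) y x.
Proof.
  intros Hf eps; destruct (Hf eps) as [d Hd].
  exists d; intros u v Hu Hv; now apply Hd.
Qed.

Lemma continuity_2d_pt_section (f : R -> R -> R) (x y : R) :
  continuity_2d_pt f x y -> continuous (fun z => f z y) x.
Proof.
  intros Hf; apply filterlim_locally; intros eps.
  destruct (Hf eps) as [d Hd]; exists d; intros z Hz.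
  apply Hd; [exact Hz|].
  replace (y - y) with 0 by ring; rewrite Rabs_R0; apply cond_pos.
Qed.

(** Continuity on the closed strip, encoded as continuity on the whole plane of the extension that
    is constant in time beyond 0 and T. This avoids one-sided limits at both ends. *)
Definition clamp_continuous (T : R) (f : R -> R -> R) : Prop :=
  forall x t, continuity_2d_pt (fun y s => f y (clamp T s)) x t.

Lemma clamp_continuous_interior (T : R) (f : R -> R -> R) (x t : R) :
  clamp_continuous T f -> 0 < t < T -> continuity_2d_pt f x t.
Proof.
  intros Hf Ht.
  apply (continuity_2d_pt_ext_loc (fun y s => f y (clamp T s))); [|apply Hf].
  apply (strip_locally_2d _ 0 T); [exact Ht|].
  intros y s Hs; rewrite clamp_id; [reflexivity|lra].
Qed.

(** * Parameter integrals and the abstract conservation law *)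

(** Uniform continuity along the compact segment at time t bounds the integrand's change uniformly
    in x. *)
Lemma continuous_RInt_param (f : R -> R -> R) (a b t : R) :
  a < b ->
  (forall x s, continuity_2d_pt f x s) ->
  continuous (fun s => RInt (fun x => f x s) a b) t.
Proof.
  intros Hab Hf; apply filterlim_locally; intros eps.
  assert (Hint : forall s, ex_RInt (fun x => f x s) a b).
  { intros s; apply (ex_RInt_continuous (V := R_CompleteNormedModule)).
    intros z _; apply continuity_2d_pt_section, Hf. }
  (* The factor 2 leaves room: the integral estimate is not strict and gives eps / 2. *)
  assert (Heta : 0 < eps / (2 * (b - a))).
  { apply Rdiv_lt_0_compat; [apply cond_pos|lra]. }
  destruct (uniform_continuity_2d_1d f a b t (fun x _ => Hf x t)
              (mkposreal _ Heta)) as [d Hd]; simpl in Hd.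
  exists d; intros s Hs.
  change (Rabs (s - t) < d) in Hs; apply Rabs_def2 in Hs.
  change (Rabs (RInt (fun x => f x s) a b - RInt (fun x => f x t) a b) < eps).
  replace (RInt (fun x => f x s) a b - RInt (fun x => f x t) a b)
    with (RInt (fun x => minus (f x s) (f x t)) a b)
    by (exact (RInt_minus (V := R_CompleteNormedModule) _ _ a b
                 (Hint s) (Hint t))).
  apply Rle_lt_trans with ((b - a) * (eps / (2 * (b - a)))).
  - apply abs_RInt_le_const; [lra| |].
    + now apply (ex_RInt_minus (V := R_NormedModule)).
    + intros x Hx; left; apply Hd; try lra.
      replace (x - x) with 0 by ring; rewrite Rabs_R0; apply cond_pos.
  - replace ((b - a) * (eps / (2 * (b - a)))) with (eps / 2) by (field; lra).
    generalize (cond_pos eps); lra.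
Qed.

(** Integrability is recorded because [RInt] is total, and assembling a complex integral from its
    parts requires genuine integrals. *)
Definition conserved (a b T : R) (F : R -> R -> R) : Prop :=
  (forall t, 0 <= t <= T -> ex_RInt (fun x => F x t) a b) /\
  (forall t, 0 <= t <= T ->
     RInt (fun x => F x t) a b = RInt (fun x => F x 0) a b).

Lemma conserved_ext (a b T : R) (F F' : R -> R -> R) :
  0 < T -> (forall x t, F x t = F' x t) ->
  conserved a b T F -> conserved a b T F'.
Proof.
  intros HT HF [Hex Hc]; split; intros t Ht.
  - apply (ex_RInt_ext (fun x => F x t)); [intros; apply HF|auto].
  - transitivity (RInt (fun x => F x t) a b).
    + apply RInt_ext; intros; symmetry; apply HF.
    + rewrite (Hc t Ht); apply RInt_ext; intros; apply HF.
Qed.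

(* Nothing is assumed for times outside [0, T]; precomposing with [clamp] makes
   the integral continuous on all of R, so that the mean value theorem applies
   although the integral is differentiated only for 0 < t < T. *)
Lemma conservation_law (a b T : R) (F Ft G Gx : R -> R -> R) :
  a < b -> 0 < T ->
  clamp_continuous T F ->
  (forall x t, 0 < t < T -> is_derive (fun s : R => F x s) t (Ft x t)) ->
  (forall x t, 0 < t < T -> continuity_2d_pt Ft x t) ->
  (forall x t, 0 < t < T -> is_derive (fun y : R => G y t) x (Gx x t)) ->
  (forall x t, a <= x <= b -> 0 < t < T -> Ft x t = Gx x t) ->
  (forall t, 0 < t < T -> G a t = G b t) ->
  conserved a b T F.
Proof.
  intros Hab HT HF HFt HFtc HG HFG Hper.
  assert (Hint : forall s, ex_RInt (fun x => F x (clamp T s)) a b).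
  { intros s; apply (ex_RInt_continuous (V := R_CompleteNormedModule)).
    intros z _.
    apply (continuity_2d_pt_section (fun y s => F y (clamp T s))), HF. }
  split.
  { intros t Ht; rewrite <- (clamp_id T t Ht); apply Hint. }
  set (J := fun s => RInt (fun x => F x (clamp T s)) a b).
  assert (HJ : forall t, 0 < t < T -> is_derive J t 0).
  { intros t Ht.
    assert (Hloc : forall x s, 0 < s < T ->
              is_derive (fun z => F x (clamp T z)) s (Ft x s)).
    { intros x s Hs; apply (is_derive_ext_loc (fun z => F x z)).
      - apply (filter_imp (fun z => 0 < z < T)).
        + intros z Hz; rewrite clamp_id; [reflexivity|lra].
        + now apply open_interval_locally.
      - now apply HFt. }
    (* Differentiation under the integral sign; near t the clamp is the identity. *)
    assert (HD : is_derive J t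
              (RInt (fun x => Derive (fun s => F x (clamp T s)) t) a b)).
    { apply (is_derive_RInt_param (fun s x => F x (clamp T s))).
      - apply (filter_imp (fun z => 0 < z < T)).
        + intros s Hs x _; exists (Ft x s); now apply Hloc.
        + now apply open_interval_locally.
      - intros x _.
        apply (continuity_2d_pt_flip
                 (fun x s => Derive (fun z => F x (clamp T z)) s)).
        apply (continuity_2d_pt_ext_loc Ft); [|now apply HFtc].
        apply (strip_locally_2d _ 0 T); [exact Ht|].
        intros y s Hs; symmetry; now apply is_derive_unique, Hloc.
      - apply filter_forall; intros s; apply Hint. }
    replace 0 with (RInt (fun x => Derive (fun s => F x (clamp T s)) t) a b);
      [exact HD|].
    transitivity (RInt (fun x => Ft x t) a b).
    { apply RInt_ext; intros x _; now apply is_derive_unique, Hloc. }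
    (* As Ft = Gx on [a, b], the integral is G(b, t) - G(a, t), which vanishes by periodicity of the
       flux. *)
    apply is_RInt_unique.
    replace 0 with (minus (G b t) (G a t))
      by (rewrite (Hper t Ht); apply (minus_eq_zero (G := R_AbelianGroup))).
    apply (is_RInt_derive (V := R_CompleteNormedModule) (fun x => G x t)).
    - rewrite Rmin_left, Rmax_right by lra; intros x Hx.
      rewrite HFG by assumption; now apply HG.
    - intros x _; apply continuity_2d_pt_section; now apply HFtc. }
  assert (HJc : forall t, continuity_pt J t).
  { intros t; apply continuity_pt_filterlim.
    now apply (continuous_RInt_param (fun x s => F x (clamp T s))). }
  intros t Ht.
  assert (HJt : J t = J 0).
  (* The derivative is required only strictly between 0 and t, so t = T is covered. *)
  { destruct (MVT_gen J 0 t (fun _ => 0)) as (c & _ & Hc).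
    - rewrite Rmin_left, Rmax_right by lra; intros s Hs; apply HJ; lra.
    - intros s _; apply HJc.
    - lra. }
  unfold J in HJt; now rewrite !clamp_id in HJt by lra.
Qed.

(** * Real components of a periodic solution and their calculus *)

(** Describes the real or imaginary part of u. One function [vtx] stands for both mixed derivatives,
    so their equality is built in. *)
Record periodic_jet (a b T : R) (v vt vx vtt vtx vxx : R -> R -> R) : Prop := {
  jet_cont    : clamp_continuous T v;
  jet_cont_t  : clamp_continuous T vt;
  jet_cont_x  : clamp_continuous T vx;
  jet_t   : forall x t, 0 < t < T -> is_derive (fun s : R => v x s) t (vt x t);
  jet_x   : forall x t, 0 < t < T -> is_derive (fun y : R => v y t) x (vx x t);
  jet_tt  : forall x t, 0 < t < T -> is_derive (fun s : R => vt x s) t (vtt x t);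
  jet_tx  : forall x t, 0 < t < T -> is_derive (fun y : R => vt y t) x (vtx x t);
  jet_xt  : forall x t, 0 < t < T -> is_derive (fun s : R => vx x s) t (vtx x t);
  jet_xx  : forall x t, 0 < t < T -> is_derive (fun y : R => vx y t) x (vxx x t);
  jet_cont_tt : forall x t, 0 < t < T -> continuity_2d_pt vtt x t;
  jet_cont_tx : forall x t, 0 < t < T -> continuity_2d_pt vtx x t;
  jet_per   : forall t, 0 < t < T -> v a t = v b t;
  jet_per_t : forall t, 0 < t < T -> vt a t = vt b t;
  jet_per_x : forall t, 0 < t < T -> vx a t = vx b t
}.

Arguments jet_cont {a b T v vt vx vtt vtx vxx} _.
Arguments jet_cont_t {a b T v vt vx vtt vtx vxx} _.
Arguments jet_cont_x {a b T v vt vx vtt vtx vxx} _.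
Arguments jet_t {a b T v vt vx vtt vtx vxx} _.
Arguments jet_x {a b T v vt vx vtt vtx vxx} _.
Arguments jet_tt {a b T v vt vx vtt vtx vxx} _.
Arguments jet_tx {a b T v vt vx vtt vtx vxx} _.
Arguments jet_xt {a b T v vt vx vtt vtx vxx} _.
Arguments jet_xx {a b T v vt vx vtt vtx vxx} _.
Arguments jet_cont_tt {a b T v vt vx vtt vtx vxx} _.
Arguments jet_cont_tx {a b T v vt vx vtt vtx vxx} _.
Arguments jet_per {a b T v vt vx vtt vtx vxx} _.
Arguments jet_per_t {a b T v vt vx vtt vtx vxx} _.
Arguments jet_per_x {a b T v vt vx vtt vtx vxx} _.

(** Densities and their time derivatives are polynomials in the entries of two jets, so the ring
    operations reduce continuity to single entries. *)
Ltac solve_continuity_2d :=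
  repeat first
    [ apply continuity_2d_pt_plus | apply continuity_2d_pt_minus
    | apply continuity_2d_pt_mult | apply continuity_2d_pt_opp
    | apply continuity_2d_pt_const ].

Ltac solve_clamp_continuous Ha Hb :=
  intros x t; solve_continuity_2d;
  first [ apply (jet_cont Ha)
        | apply (jet_cont_t Ha)
        | apply (jet_cont_x Ha)
        | apply (jet_cont Hb)
        | apply (jet_cont_t Hb)
        | apply (jet_cont_x Hb) ].

Ltac solve_interior_continuity Ha Hb :=
  intros x t Ht; solve_continuity_2d;
  first [ now apply (jet_cont_tt Ha)
        | now apply (jet_cont_tx Ha)
        | now apply (jet_cont_tt Hb)
        | now apply (jet_cont_tx Hb)
        | apply (clamp_continuous_interior _ _ _ _
                   (jet_cont Ha) Ht)
        | apply (clamp_continuous_interior _ _ _ _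
                   (jet_cont_t Ha) Ht)
        | apply (clamp_continuous_interior _ _ _ _
                   (jet_cont_x Ha) Ht)
        | apply (clamp_continuous_interior _ _ _ _
                   (jet_cont Hb) Ht)
        | apply (clamp_continuous_interior _ _ _ _
                   (jet_cont_t Hb) Ht)
        | apply (clamp_continuous_interior _ _ _ _
                   (jet_cont_x Hb) Ht) ].

(** [auto_derive] answers in terms of [Derive] of each entry; rewriting with the jet's own
    derivatives leaves a polynomial identity. *)
Ltac solve_derive_t Ha Hb :=
  intros x t Ht;
  pose proof (jet_t Ha x t Ht) as D1;
  pose proof (jet_tt Ha x t Ht) as D2;
  pose proof (jet_xt Ha x t Ht) as D3;
  pose proof (jet_t Hb x t Ht) as D4;
  pose proof (jet_tt Hb x t Ht) as D5;
  pose proof (jet_xt Hb x t Ht) as D6;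
  auto_derive;
  [ repeat split; try exact I; eexists; eassumption
  | rewrite ?(is_derive_unique _ _ _ D1), ?(is_derive_unique _ _ _ D2),
      ?(is_derive_unique _ _ _ D3), ?(is_derive_unique _ _ _ D4),
      ?(is_derive_unique _ _ _ D5), ?(is_derive_unique _ _ _ D6);
    field ].

Ltac solve_derive_x Ha Hb :=
  intros x t Ht;
  pose proof (jet_x Ha x t Ht) as D1;
  pose proof (jet_tx Ha x t Ht) as D2;
  pose proof (jet_xx Ha x t Ht) as D3;
  pose proof (jet_x Hb x t Ht) as D4;
  pose proof (jet_tx Hb x t Ht) as D5;
  pose proof (jet_xx Hb x t Ht) as D6;
  auto_derive;
  [ repeat split; try exact I; eexists; eassumption
  | rewrite ?(is_derive_unique _ _ _ D1), ?(is_derive_unique _ _ _ D2),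
      ?(is_derive_unique _ _ _ D3), ?(is_derive_unique _ _ _ D4),
      ?(is_derive_unique _ _ _ D5), ?(is_derive_unique _ _ _ D6);
    field ].

Ltac solve_periodicity Ha Hb :=
  intros t Ht;
  now rewrite ?(jet_per Ha t Ht),
    ?(jet_per_t Ha t Ht),
    ?(jet_per_x Ha t Ht),
    ?(jet_per Hb t Ht),
    ?(jet_per_t Hb t Ht),
    ?(jet_per_x Hb t Ht).

(* Holds without the equation: the density is half of [(|u|^2)_x], whose time
   derivative is [(Re (u u_t^bar))_x]. *)
Lemma conserved_re_u_conj_ux (xl xr T k : R)
  (p pt px ptt ptx pxx q qt qx qtt qtx qxx : R -> R -> R) :
  xl < xr -> 0 < T ->
  periodic_jet xl xr T p pt px ptt ptx pxx ->
  periodic_jet xl xr T q qt qx qtt qtx qxx ->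
  conserved xl xr T
    (fun x t => k * (p x t * px x t + q x t * qx x t)).
Proof.
  intros Hx HT Hp Hq.
  apply (conservation_law _ _ _ _
    (fun x t => k * (pt x t * px x t + p x t * ptx x t
                     + (qt x t * qx x t + q x t * qtx x t)))
    (fun x t => k * (p x t * pt x t + q x t * qt x t))
    (fun x t => k * (pt x t * px x t + p x t * ptx x t
                     + (qt x t * qx x t + q x t * qtx x t))));
    try assumption.
  - solve_clamp_continuous Hp Hq.
  - solve_derive_t Hp Hq.
  - solve_interior_continuity Hp Hq.
  - solve_derive_x Hp Hq.
  - reflexivity.
  - solve_periodicity Hp Hq.
Qed.

(** * The equation in real form and its two local laws *)

Definition wave_equation (xl xr T alpha gamma theta lambda beta : R)
  (p pt px ptt ptx pxx q qt qx qtt qtx qxx : R -> R -> R) : Prop :=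
  forall x t, xl <= x <= xr -> 0 < t < T ->
    ptt x t - pxx x t + gamma * ptx x t + alpha * qt x t + theta * qx x t
      + lambda * p x t
      + beta * (p x t * p x t + q x t * q x t) * p x t = 0 /\
    qtt x t - qxx x t + gamma * qtx x t - alpha * pt x t - theta * px x t
      + lambda * q x t
      + beta * (p x t * p x t + q x t * q x t) * q x t = 0.

(** This density is the real part of the energy density. Under the multiplier conj u_t the alpha
    terms cancel, the gamma term is an x-derivative, and the theta term splits between density and
    flux. *)
Lemma conserved_energy_re (xl xr T alpha gamma theta lambda beta : R)
  (p pt px ptt ptx pxx q qt qx qtt qtx qxx : R -> R -> R) :
  xl < xr -> 0 < T ->
  periodic_jet xl xr T p pt px ptt ptx pxx ->
  periodic_jet xl xr T q qt qx qtt qtx qxx ->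
  wave_equation xl xr T alpha gamma theta lambda beta
    p pt px ptt ptx pxx q qt qx qtt qtx qxx ->
  conserved xl xr T
    (fun x t => (pt x t * pt x t + qt x t * qt x t)
      + (px x t * px x t + qx x t * qx x t)
      - theta * (q x t * px x t - p x t * qx x t)
      + lambda * (p x t * p x t + q x t * q x t)
      + beta / 2 * ((p x t * p x t + q x t * q x t)
                    * (p x t * p x t + q x t * q x t))).
Proof.
  intros Hx HT Hp Hq Heq.
  apply (conservation_law _ _ _ _
    (fun x t => 2 * (pt x t * ptt x t + qt x t * qtt x t)
      + 2 * (px x t * ptx x t + qx x t * qtx x t)
      - theta * (qt x t * px x t + q x t * ptx x t
                 - (pt x t * qx x t + p x t * qtx x t))
      + 2 * lambda * (p x t * pt x t + q x t * qt x t)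
      + 2 * beta * ((p x t * p x t + q x t * q x t)
                    * (p x t * pt x t + q x t * qt x t)))
    (* The flux is 2 Re(u_x conj u_t) - gamma |u_t|^2 - theta Im(u conj u_t). *)
    (fun x t => 2 * (px x t * pt x t + qx x t * qt x t)
      - gamma * (pt x t * pt x t + qt x t * qt x t)
      - theta * (q x t * pt x t - p x t * qt x t))
    (fun x t => 2 * (pxx x t * pt x t + px x t * ptx x t
                     + (qxx x t * qt x t + qx x t * qtx x t))
      - 2 * gamma * (pt x t * ptx x t + qt x t * qtx x t)
      - theta * (qx x t * pt x t + q x t * ptx x t
                 - (px x t * qt x t + p x t * qtx x t))));
    try assumption.
  - solve_clamp_continuous Hp Hq.
  - solve_derive_t Hp Hq.
  - solve_interior_continuity Hp Hq.
  - solve_derive_x Hp Hq.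
  - intros x t Hxt Ht; destruct (Heq x t Hxt Ht) as [E1 E2].
    apply Rminus_diag_uniq.
    match type of E1 with ?e1 = 0 => match type of E2 with ?e2 = 0 =>
      (* F_t - G_x is twice the real part of the equation times conj u_t. *)
      transitivity (2 * pt x t * e1 + 2 * qt x t * e2);
      [ring | rewrite E1, E2; ring] end end.
  - solve_periodicity Hp Hq.
Qed.

(** This density is the imaginary part of the mass density. Under the multiplier conj u the lambda
    and beta terms become real and drop out, alpha yields a time derivative, theta an x-derivative,
    and the mixed gamma term is shared by density and flux. *)
Lemma conserved_mass_im (xl xr T alpha gamma theta lambda beta : R)
  (p pt px ptt ptx pxx q qt qx qtt qtx qxx : R -> R -> R) :
  xl < xr -> 0 < T ->
  periodic_jet xl xr T p pt px ptt ptx pxx ->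
  periodic_jet xl xr T q qt qx qtt qtx qxx ->
  wave_equation xl xr T alpha gamma theta lambda beta
    p pt px ptt ptx pxx q qt qx qtt qtx qxx ->
  conserved xl xr T
    (fun x t => 2 * (qt x t * p x t - pt x t * q x t)
      - gamma * (q x t * px x t - p x t * qx x t)
      - alpha * (p x t * p x t + q x t * q x t)).
Proof.
  intros Hx HT Hp Hq Heq.
  apply (conservation_law _ _ _ _
    (fun x t => 2 * (qtt x t * p x t - ptt x t * q x t)
      - gamma * (qt x t * px x t + q x t * ptx x t
                 - (pt x t * qx x t + p x t * qtx x t))
      - 2 * alpha * (p x t * pt x t + q x t * qt x t))
    (* The flux is 2 Im(u_x conj u) + theta |u|^2 - gamma Im(u_t conj u). *)
    (fun x t => 2 * (qx x t * p x t - px x t * q x t)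
      + theta * (p x t * p x t + q x t * q x t)
      - gamma * (qt x t * p x t - pt x t * q x t))
    (fun x t => 2 * (qxx x t * p x t - pxx x t * q x t)
      + 2 * theta * (p x t * px x t + q x t * qx x t)
      - gamma * (qtx x t * p x t + qt x t * px x t
                 - (ptx x t * q x t + pt x t * qx x t))));
    try assumption.
  - solve_clamp_continuous Hp Hq.
  - solve_derive_t Hp Hq.
  - solve_interior_continuity Hp Hq.
  - solve_derive_x Hp Hq.
  - intros x t Hxt Ht; destruct (Heq x t Hxt Ht) as [E1 E2].
    apply Rminus_diag_uniq.
    match type of E1 with ?e1 = 0 => match type of E2 with ?e2 = 0 =>
      transitivity (2 * p x t * e2 - 2 * q x t * e1);
      [ring | rewrite E1, E2; ring] end end.
  - solve_periodicity Hp Hq.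
Qed.

(** * From the complex solution to its real components *)

(** Right difference quotients alone determine a two-sided derivative. Periodicity is assumed only
    for x in [xl, xr], hence only to the right of xl. *)
Lemma flat_right_derive_zero (g : R -> R) (a b l : R) :
  a < b -> (forall x, a <= x <= b -> g x = 0) -> is_derive g a l -> l = 0.
Proof.
  intros Hab Hg Hd; apply is_derive_Reals in Hd.
  destruct (Req_dec l 0) as [Hl|Hl]; [exact Hl|exfalso].
  (* With tolerance |l|, a vanishing quotient gives the contradiction |l| < |l|. *)
  destruct (Hd (Rabs l) (Rabs_pos_lt l Hl)) as [d Hdd].
  assert (Hpos := cond_pos d).
  set (h := Rmin (d / 2) (b - a)).
  assert (Hh : 0 < h) by (apply Rmin_glb_lt; lra).
  assert (Hhd : h <= d / 2) by apply Rmin_l.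
  assert (Hhb : h <= b - a) by apply Rmin_r.
  assert (H : Rabs ((g (a + h) - g a) / h - l) < Rabs l).
  { apply Hdd; [lra|]; rewrite Rabs_pos_eq; lra. }
  rewrite !Hg in H by lra.
  replace ((0 - 0) / h - l) with (- l) in H by (field; lra).
  rewrite Rabs_Ropp in H; lra.
Qed.

Lemma within_interior (D P : R -> Prop) (t : R) :
  locally t D -> within D (locally t) P -> locally t P.
Proof.
  intros HD HP; generalize (filter_and _ _ HD HP).
  apply filter_imp; intros x [H1 H2]; auto.
Qed.

Lemma is_derive_within_interior (D : R -> Prop) (f : R -> C) (t : R) (l : C) :
  locally t D -> is_derive_within D f t l ->
  is_derive (K := R_AbsRing) (V := C_R_NormedModule) f t l.
Proof.
  intros HD [Hlin Hdom]; split; [apply is_linear_scal_l|].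
  intros x Hx.
  assert (Hxt : t = x)
    by exact (is_filter_lim_locally_unique (V := R_NormedModule) t x Hx).
  subst x; intros eps.
  apply (within_interior D); [exact HD|].
  apply Hdom; intros P HP; now apply filter_le_within, Hx.
Qed.

(** Taking [proj] to be [fst] or [snd] later treats real and imaginary parts together. *)
Lemma is_derive_linear (proj : C -> R) (f : R -> C) (x : R) (l : C) :
  is_linear (K := R_AbsRing) (U := C_R_NormedModule) (V := R_NormedModule)
    proj ->
  is_derive (K := R_AbsRing) (V := C_R_NormedModule) f x l ->
  is_derive (fun y : R => proj (f y)) x (proj l).
Proof.
  intros Hp Hf.
  apply (filterdiff_ext_lin _ (fun y : R => proj (scal (V := C_R_NormedModule) y l))).
  - apply (filterdiff_comp' (U := R_NormedModule) (V := C_R_NormedModule)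
             (W := R_NormedModule) f proj x _ proj Hf).
    now apply filterdiff_linear.
  - intros y; exact (linear_scal (U := C_R_NormedModule) proj Hp y l).
Qed.

(** Clamping time is 1-Lipschitz and lands in the closed strip, so it turns continuity relative to
    the strip into continuity on the plane. *)
Lemma jointly_continuous_clamp (proj : C -> R) (T : R) (v : R -> R -> C) :
  is_linear (K := R_AbsRing) (U := C_R_NormedModule) (V := R_NormedModule)
    proj ->
  0 < T -> jointly_continuous (fun t => 0 <= t <= T) v ->
  clamp_continuous T (fun x t => proj (v x t)).
Proof.
  intros Hp HT Hv x t.
  apply continuity_2d_pt_filterlim.
  apply (filterlim_comp _ _ _ (fun z : R * R => v (fst z) (clamp T (snd z)))
           proj _ (locally (v x (clamp T t)))).
  - apply (filterlim_comp _ _ _ (fun z : R * R => (fst z, clamp T (snd z)))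
             (fun z => v (fst z) (snd z)) _
             (within (fun p => 0 <= snd p <= T) (locally (x, clamp T t)))).
    + intros P HP; destruct HP as [d Hd]; exists d.
      intros [y s] [Hy Hs]; apply Hd; [|apply clamp_range; exact HT].
      split; [exact Hy|].
      apply Rle_lt_trans with (Rabs (s - t)); [|exact Hs].
      apply clamp_contracting, HT.
    + apply (Hv (x, clamp T t)); apply clamp_range, HT.
  - exact (linear_cont (U := C_R_NormedModule) proj _ Hp).
Qed.

Lemma jointly_continuous_interior (proj : C -> R) (T : R) (v : R -> R -> C)
  (x t : R) :
  is_linear (K := R_AbsRing) (U := C_R_NormedModule) (V := R_NormedModule)
    proj ->
  0 < t < T -> jointly_continuous (fun t => 0 < t <= T) v ->
  continuity_2d_pt (fun x t => proj (v x t)) x t.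
Proof.
  intros Hp Ht Hv.
  apply continuity_2d_pt_filterlim.
  apply (filterlim_comp _ _ _ (fun z : R * R => v (fst z) (snd z))
           proj _ (locally (v x t))); [|exact (linear_cont (U := C_R_NormedModule) proj _ Hp)].
  intros P HP.
  assert (HI : 0 < t <= T) by lra.
  specialize (Hv (x, t) HI P HP).
  destruct (open_interval_locally 0 T t Ht) as [d Hd].
  assert (Hstrip : locally (T := prod_UniformSpace R_UniformSpace R_UniformSpace)
                     (x, t) (fun z => 0 < snd z <= T)).
  { exists d; intros [y s] [_ Hs]; specialize (Hd s Hs); simpl; lra. }
  unfold filtermap, within in Hv |- *.
  refine (filter_imp _ _ _ (filter_and _ _ Hstrip Hv)).
  intros z [H1 H2]; now apply H2.
Qed.

(** Schwarz's theorem speaks of iterated [Derive]; in the open strip these coincide with the named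
    partials. *)
Lemma mixed_partials_eq (T : R) (f ft fx ftx fxt : R -> R -> R) (x t : R) :
  0 < t < T ->
  (forall y s, 0 < s < T -> is_derive (fun r : R => f y r) s (ft y s)) ->
  (forall y s, 0 < s < T -> is_derive (fun z : R => f z s) y (fx y s)) ->
  (forall y s, 0 < s < T -> is_derive (fun z : R => ft z s) y (ftx y s)) ->
  (forall y s, 0 < s < T -> is_derive (fun r : R => fx y r) s (fxt y s)) ->
  (forall y s, 0 < s < T -> continuity_2d_pt ftx y s) ->
  (forall y s, 0 < s < T -> continuity_2d_pt fxt y s) ->
  ftx x t = fxt x t.
Proof.
  intros Ht Hft Hfx Hftx Hfxt Ctx Cxt.
  assert (Dtx : forall y s, 0 < s < T ->
            is_derive (fun z : R => Derive (fun r : R => f z r) s) y (ftx y s)).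
  { intros y s Hs; apply (is_derive_ext (fun z : R => ft z s)).
    - intros z; symmetry; now apply is_derive_unique, Hft.
    - now apply Hftx. }
  assert (Dxt : forall y s, 0 < s < T ->
            is_derive (fun r : R => Derive (fun z : R => f z r) y) s (fxt y s)).
  (* Varying the time can leave the strip, so agreement is only local here. *)
  { intros y s Hs; apply (is_derive_ext_loc (fun r : R => fx y r)).
    - apply (filter_imp (fun r => 0 < r < T)).
      + intros r Hr; symmetry; now apply is_derive_unique, Hfx.
      + now apply open_interval_locally.
    - now apply Hfxt. }
  rewrite <- (is_derive_unique _ _ _ (Dtx x t Ht)).
  rewrite <- (is_derive_unique _ _ _ (Dxt x t Ht)).
  apply Schwarz.
  - apply (strip_locally_2d _ 0 T); [exact Ht|]; intros y s Hs.
    repeat split; eexists; eauto.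
  - apply (continuity_2d_pt_ext_loc ftx); [|now apply Ctx].
    apply (strip_locally_2d _ 0 T); [exact Ht|].
    intros y s Hs; symmetry; now apply is_derive_unique, Dtx.
  - apply (continuity_2d_pt_ext_loc fxt); [|now apply Cxt].
    apply (strip_locally_2d _ 0 T); [exact Ht|].
    intros y s Hs; symmetry; now apply is_derive_unique, Dxt.
Qed.

Lemma periodic_jet_of_solution (proj : C -> R) (xl xr T : R)
  (u ut ux utt utx uxt uxx : R -> R -> C) :
  is_linear (K := R_AbsRing) (U := C_R_NormedModule) (V := R_NormedModule)
    proj ->
  xl < xr -> 0 < T ->
  classical_regularity T u ut ux utt utx uxt uxx ->
  (forall x t, xl <= x <= xr -> 0 <= t <= T ->
     u x t = u (x + (xr - xl)) t) ->
  periodic_jet xl xr T (fun x t => proj (u x t)) (fun x t => proj (ut x t))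
    (fun x t => proj (ux x t)) (fun x t => proj (utt x t))
    (fun x t => proj (utx x t)) (fun x t => proj (uxx x t)).
Proof.
  intros Hp Hx HT Hreg Hper.
  assert (Dt : forall (I : R -> Prop) v vt,
            (forall t, 0 < t < T -> I t) ->
            is_partial_t T I v vt ->
            forall x t, 0 < t < T ->
            is_derive (fun s : R => proj (v x s)) t (proj (vt x t))).
  { intros I v vt HI Hv x t Ht; apply is_derive_linear; [exact Hp|].
    apply (is_derive_within_interior (fun s => 0 <= s <= T)).
    - apply (filter_imp (fun s => 0 < s < T)); [intros; lra|].
      now apply open_interval_locally.
    - now apply Hv, HI. }
  assert (Dx : forall (I : R -> Prop) v vx,
            (forall t, 0 < t < T -> I t) ->
            is_partial_x I v vx ->
            forall x t, 0 < t < T ->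
            is_derive (fun y : R => proj (v y t)) x (proj (vx x t))).
  { intros I v vx HI Hv x t Ht; apply is_derive_linear; [exact Hp|].
    now apply Hv, HI. }
  destruct Hreg as [rt rx rtt rtx rxt rxx c ct cx ctt ctx cxt cxx].
  assert (Pt : forall t, 0 < t < T -> 0 <= t <= T) by (intros; lra).
  assert (Pt' : forall t, 0 < t < T -> 0 < t <= T) by (intros; lra).
  assert (Ctx : forall y s, 0 < s < T ->
            continuity_2d_pt (fun x t => proj (utx x t)) y s)
    by (intros; now apply (jointly_continuous_interior proj T)).
  assert (Eper : forall t, 0 <= t <= T -> u xl t = u xr t).
  { intros t Ht; rewrite (Hper xl t) by lra; f_equal; ring. }
  constructor.
  - now apply jointly_continuous_clamp.
  - now apply jointly_continuous_clamp.
  - now apply jointly_continuous_clamp.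
  - now apply (Dt _ u ut Pt).
  - now apply (Dx _ u ux Pt).
  - now apply (Dt _ ut utt Pt').
  - now apply (Dx _ ut utx Pt').
  - intros x t Ht.
    rewrite (mixed_partials_eq T (fun x t => proj (u x t))
      (fun x t => proj (ut x t)) (fun x t => proj (ux x t))
      (fun x t => proj (utx x t)) (fun x t => proj (uxt x t)) x t Ht).
    + now apply (Dt _ ux uxt Pt').
    + now apply (Dt _ u ut Pt).
    + now apply (Dx _ u ux Pt).
    + now apply (Dx _ ut utx Pt').
    + now apply (Dt _ ux uxt Pt').
    + exact Ctx.
    + intros; now apply (jointly_continuous_interior proj T).
  - now apply (Dx _ ux uxx Pt').
  - intros; now apply (jointly_continuous_interior proj T).
  - exact Ctx.
  - intros t Ht; now rewrite (Eper t (Pt t Ht)).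
  (* The time traces of u at xl and xr agree near t, hence so do their derivatives. *)
  - intros t Ht.
    transitivity (Derive (fun s : R => proj (u xr s)) t);
      [|now apply is_derive_unique, (Dt _ u ut Pt)].
    symmetry; apply is_derive_unique.
    apply (is_derive_ext_loc (fun s : R => proj (u xl s)));
      [|now apply (Dt _ u ut Pt)].
    apply (filter_imp (fun s => 0 < s < T)).
    + intros s Hs; now rewrite (Eper s (Pt s Hs)).
    + now apply open_interval_locally.
  (* The difference of u and its translate vanishes on [xl, xr]; its derivative at xl is u_x(xl, t)
     - u_x(xr, t), up to [proj]. *)
  - intros t Ht; apply Rminus_diag_uniq.
    apply (flat_right_derive_zero
             (fun x => proj (u x t) - proj (u (x + (xr - xl)) t)) xl xr _ Hx).
    + intros x Hxx; rewrite (Hper x t Hxx (Pt t Ht)); ring.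
    + pose proof (Dx _ u ux Pt rx xl t Ht) as D1.
      pose proof (Dx _ u ux Pt rx xr t Ht) as D2.
      apply (is_derive_minus (V := R_NormedModule)); [exact D1|].
      replace (proj (ux xr t)) with (scal 1 (proj (ux xr t)))
        by apply (scal_one (V := R_ModuleSpace)).
      apply (is_derive_comp (V := R_NormedModule)
               (fun y : R => proj (u y t)) (fun x : R => x + (xr - xl))).
      * now replace (xl + (xr - xl)) with xr by ring.
      * auto_derive; [exact I|ring].
Qed.

(** * Complex integrals and the two invariants *)

Lemma RInt_C_conserved (a b T : R) (F : R -> R -> C) :
  conserved a b T (fun x t => fst (F x t)) ->
  conserved a b T (fun x t => snd (F x t)) ->
  forall t, 0 <= t <= T ->
    RInt (V := C_R_CompleteNormedModule) (fun x => F x t) a b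
    = RInt (V := C_R_CompleteNormedModule) (fun x => F x 0) a b.
Proof.
  intros [Hre Ere] [Him Eim] t Ht.
  assert (H : forall s, 0 <= s <= T ->
            RInt (V := C_R_CompleteNormedModule) (fun x => F x s) a b
            = (RInt (fun x => fst (F x s)) a b,
               RInt (fun x => snd (F x s)) a b)).
  { intros s Hs; apply is_RInt_unique.
    apply (is_RInt_fct_extend_pair (U := R_NormedModule) (V := R_NormedModule)
             (fun x => F x s)).
    - apply (RInt_correct (V := R_CompleteNormedModule)); auto.
    - apply (RInt_correct (V := R_CompleteNormedModule)); auto. }
  rewrite !H by lra; now rewrite (Ere t Ht), (Eim t Ht).
Qed.

Lemma Cmod_sqr (z : C) : Cmod z ^ 2 = fst z * fst z + snd z * snd z.
Proof. unfold Cmod; rewrite pow2_sqrt; [ring|nra]. Qed.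

Lemma Cmod_pow4 (z : C) :
  Cmod z ^ 4 = (fst z * fst z + snd z * snd z) * (fst z * fst z + snd z * snd z).
Proof.
  replace (Cmod z ^ 4) with (Cmod z ^ 2 * Cmod z ^ 2) by ring.
  now rewrite Cmod_sqr.
Qed.

Local Open Scope C_scope.

Theorem proposition1
  (alpha gamma theta lambda beta xl xr T : R) (f0 f1 : R -> C)
  (u ut ux utt utx uxt uxx : R -> R -> C)
  (Hx : (xl < xr)%R) (HT : (0 < T)%R)
  (Hreg : classical_regularity T u ut ux utt utx uxt uxx)
  (Heq : forall x t : R, (xl <= x <= xr)%R -> (0 < t <= T)%R ->
     utt x t - uxx x t + RtoC gamma * utx x t
     - Ci * RtoC alpha * ut x t - Ci * RtoC theta * ux x t
     + RtoC lambda * u x t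
     + RtoC beta * RtoC (Cmod (u x t) ^ 2) * u x t = 0)
  (Hper : forall x t : R, (xl <= x <= xr)%R -> (0 <= t <= T)%R ->
     u x t = u (x + (xr - xl))%R t)
  (Hf0 : forall x : R, (xl <= x <= xr)%R -> u x 0 = f0 x)
  (Hf1 : forall x : R, (xl <= x <= xr)%R -> ut x 0 = f1 x) :
  (forall t : R, (0 <= t <= T)%R ->
     energy xl xr theta lambda beta u ut ux t
     = energy xl xr theta lambda beta u ut ux 0)
  /\
  (forall t : R, (0 <= t <= T)%R ->
     mass xl xr alpha gamma u ut ux t = mass xl xr alpha gamma u ut ux 0).

Proof.
  pose proof (periodic_jet_of_solution fst _ _ _ _ _ _ _ _ _ _
                (is_linear_fst (U := R_NormedModule) (V := R_NormedModule))
                Hx HT Hreg Hper) as Hre.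
  pose proof (periodic_jet_of_solution snd _ _ _ _ _ _ _ _ _ _
                (is_linear_snd (U := R_NormedModule) (V := R_NormedModule))
                Hx HT Hreg Hper) as Him.
  simpl in Hre, Him.
  assert (Henergy := fun H => conserved_energy_re _ _ _ alpha gamma theta lambda
                    beta _ _ _ _ _ _ _ _ _ _ _ _ Hx HT Hre Him H).
  assert (Hmass := fun H => conserved_mass_im _ _ _ alpha gamma theta lambda
                    beta _ _ _ _ _ _ _ _ _ _ _ _ Hx HT Hre Him H).
  assert (Hre_flux := fun k => conserved_re_u_conj_ux _ _ _ k
                    _ _ _ _ _ _ _ _ _ _ _ _ Hx HT Hre Him).
  (* The shared premise [W] is the complex equation split into real and imaginary parts. *)
  match type of Henergy with ?W -> _ => assert (HW : W) end.
  { intros x t Hxt Ht.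
    assert (Ht' : (0 < t <= T)%R) by lra.
    pose proof (Heq x t Hxt Ht') as E; rewrite Cmod_sqr in E.
    pose proof (f_equal fst E) as E1; pose proof (f_equal snd E) as E2.
    simpl in E1, E2; split; [rewrite <- E1|rewrite <- E2]; ring. }
  specialize (Henergy HW); specialize (Hmass HW).
  split; unfold energy, mass.
  - apply (RInt_C_conserved xl xr T (fun x t => _)).
    + refine (conserved_ext _ _ _ _ _ HT _ Henergy); intros x t; cbv beta.
      rewrite Cmod_pow4, !Cmod_sqr; simpl; ring.
    (* Only i theta u conj u_x has an imaginary part, namely theta Re(u conj u_x). *)
    + refine (conserved_ext _ _ _ _ _ HT _ (Hre_flux theta)).
      intros x t; simpl; ring.
  - apply (RInt_C_conserved xl xr T (fun x t => _)).
    (* The bracket u_t conj u - conj u_t u is purely imaginary, so the real part is -gamma Re(u conj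
       u_x). *)
    + refine (conserved_ext _ _ _ _ _ HT _ (Hre_flux (- gamma)%R)).
      intros x t; simpl; ring.
    + refine (conserved_ext _ _ _ _ _ HT _ Hmass); intros x t; cbv beta.
      rewrite !Cmod_sqr; simpl; ring.
Qed.
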